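(* Let $\mathbb{K}$ be a field and let $M$ and $N$ be dg $\mathbb{K}[u]$-modules, where $\deg u=2$. Then $$d_{\mathrm{HI}}(\alpha M,\alpha N)=\max\{d^k_{\mathrm{CohI}}(M,N)\mid k=0,1\}.$$
   Context: A dg $\mathbb{K}[u]$-module is a cochain complex $M=\{M^l,\partial\}_{l\in\mathbb{Z}}$ of $\mathbb{K}$-vector spaces (not necessarily bounded) with a linear map $u:M^l\to M^{l+2}$ satisfying $u\partial=\partial u$. $\mathsf{Ch}_{\mathbb{K}}$ is the category of cochain complexes over $\mathbb{K}$, with quasi-isomorphisms as weak equivalences; $\mathcal{C}^{(\mathbb{R},\leq)}$ is the category of functors from the poset $(\mathbb{R},\leq)$ to $\mathcal{C}$; weak equivalences in $\mathsf{Ch}_{\mathbb{K}}^{(\mathbb{R},\leq)}$ are pointwise. The functor $\alpha$ sends $M$ to the object $\alpha M$ of $\mathsf{Ch}_{\mathbb{K}}^{(\mathbb{R},\leq)}$ with $\alpha M(r)=\Sigma^{2\lfloor r\rfloor}M$, where $(\Sigma^lA)^i=A^{i+l}$, and with structure map $\alpha M(r\to s)$ the multiplication by $u^{\lfloor s\rfloor-\lfloor r\rfloor}$ for $r\le s$. For $k\in\mathbb{Z}$, $\nu^kM$ is the persistence vector space (functor from $(\mathbb{R},\leq)$ to $\mathbb{K}$-vector spaces) $\nu^kM(r)=H^k(\alpha M(r))=H^{k+2\lfloor r\rfloor}(M)$ with structure maps induced by multiplication by powers of $u$. Interleavings: for $F\in\mathcal{C}^{(\mathbb{R},\leq)}$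 and $\varepsilon\ge0$, $F^{\varepsilon}(a)=F(a+\varepsilon)$. $F,G$ are $\varepsilon$-interleaved if there are natural transformations $\varphi:F\to G^{\varepsilon}$, $\psi:G\to F^{\varepsilon}$ with $\psi^{\varepsilon}\varphi:F\to F^{2\varepsilon}$ and $\varphi^{\varepsilon}\psi:G\to G^{2\varepsilon}$ the structure maps. $d_{\mathrm I}(F,G)$ is the infimum in $[0,\infty]$ of such $\varepsilon$. $d^k_{\mathrm{CohI}}(M,N):=d_{\mathrm I}(\nu^kM,\nu^kN)$ for $k=0,1$. Objects $X,Y$ of $\mathsf{Ch}_{\mathbb{K}}^{(\mathbb{R},\leq)}$ are $\varepsilon$-homotopy interleaved if there are objects $X',Y'$, connected to $X$ and $Y$ respectively by zigzags of weak equivalences, which are $\varepsilon$-interleaved; $d_{\mathrm{HI}}(X,Y)$ is the infimum in $[0,\infty]$ of such $\varepsilon\geq 0$. *)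

(* Defs.v *)
From HB Require Import structures.
From mathcomp Require Import all_boot all_order all_algebra.
From mathcomp Require Import boolp classical_sets reals constructive_ereal ereal.
Set Implicit Arguments.
Unset Strict Implicit.
Unset Printing Implicit Defensive.
Import Order.TTheory GRing.Theory Num.Theory.
Local Open Scope ring_scope.
Local Open Scope quotient_scope.

Record category := Category {
  ob : Type;
  hom : ob -> ob -> Type;
  idm : forall A, hom A A;
  compm : forall A B C, hom B C -> hom A B -> hom A C;
  comp1m : forall A B (f : hom A B), compm (idm B) f = f;
  compm1 : forall A B (f : hom A B), compm f (idm A) = f;
  compmA : forall A B C D (h : hom C D) (g : hom B C) (f : hom A B),
    compm h (compm g f) = compm (compm h g) f }.
Arguments idm {c} A.
Arguments compm {c A B C}.

Record functor (C D : category) := Functor {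
  fob : ob C -> ob D;
  fmap : forall A B, hom A B -> hom (fob A) (fob B);
  fmap1 : forall A, fmap (idm A) = idm (fob A);
  fmapM : forall A B E (g : hom B E) (f : hom A B),
    fmap (compm g f) = compm (fmap g) (fmap f) }.
Arguments fmap {C D} _ {A B}.

(* A functor from the poset (R, <=) to C. *)
Record pers (R : realType) (C : category) := Pers {
  pob : R -> ob C;
  pmor : forall r s : R, r <= s -> hom (pob r) (pob s);
  pmor1 : forall r (rr : r <= r), pmor rr = idm (pob r);
  pmorM : forall r s t (rs : r <= s) (st : s <= t) (rt : r <= t),
    pmor rt = compm (pmor st) (pmor rs) }.
Arguments pob {R C} _ r.
Arguments pmor {R C} _ {r s}.

Record nat_trans (R : realType) (C : category) (F G : pers R C) := NatTrans {
  ncomp : forall r, hom (pob F r) (pob G r);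
  natural : forall r s (rs : r <= s),
    compm (ncomp s) (pmor F rs) = compm (pmor G rs) (ncomp r) }.
Arguments ncomp {R C F G} _ r.

Definition pers_comp (R : realType) (C D : category) (T : functor C D)
  (F : pers R C) : pers R D.
Proof.
exists (fun r => fob T (pob F r)) (fun r s rs => fmap T (pmor F rs)).
- by move=> r rr; rewrite pmor1 fmap1.
- by move=> r s t rs st rt; rewrite (pmorM F rs st rt) fmapM.
Defined.

Lemma le_shift (R : realType) (e r s : R) : r <= s -> r + e <= s + e.
Proof. by rewrite lerD2r. Qed.

Definition pers_shift (R : realType) (C : category) (F : pers R C) (e : R) :
  pers R C.
Proof.
exists (fun r => pob F (r + e)) (fun r s rs => pmor F (le_shift e rs)).
- by move=> r rr; rewrite pmor1.
- by move=> r s t rs st rt; apply: pmorM.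
Defined.

Lemma le_shift2 (R : realType) (e r : R) : 0 <= e -> r <= r + e + e.
Proof. by move=> e0; rewrite -addrA lerDl addr_ge0. Qed.

(* (F^e)^e stands for F^(2e): the value at r is F (r + e + e). *)
Definition interleaved (R : realType) (C : category) (F G : pers R C) (e : R) :
    Prop :=
  exists (e0 : 0 <= e) (phi : nat_trans F (pers_shift G e))
         (psi : nat_trans G (pers_shift F e)),
    (forall r, compm (ncomp psi (r + e)) (ncomp phi r)
               = pmor F (le_shift2 r e0))
    /\
    (forall r, compm (ncomp phi (r + e)) (ncomp psi r)
               = pmor G (le_shift2 r e0)).

Definition d_I (R : realType) (C : category) (F G : pers R C) : \bar R :=
  ereal_inf [set e%:E | e in [set e : R | interleaved F G e]]%classic.

Lemma linear_ext (K : fieldType) (U V : lmodType K) (f g : {linear U -> V}) :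
  f =1 g -> f = g.
Proof.
case: f g => [f [[a] [b]]] [g [[a'] [b']]] /= /funext fg.
subst g; by rewrite (Prop_irrelevance a a') (Prop_irrelevance b b').
Qed.

Definition Vect (K : fieldType) : category.
Proof.
exists (lmodType K) (fun U V : lmodType K => {linear U -> V})
  (fun U => idfun) (fun U V W g f => g \o f); by move=> *; apply: linear_ext.
Defined.

(* Cochain complexes.  The differential is given as a map X i -> X j for every
   (necessarily unique) proof of j = i + 1, so that shifting a complex involves
   no transport along equalities of degrees; the action of u on a dg
   K[u]-module below follows the same convention with j = i + 2. *)

Record cochain (K : fieldType) := Cochain {
  deg :> int -> lmodType K;
  cdiff : forall i j : int, j = i + 1 -> {linear deg i -> deg j};
  cdiffK : forall i j k (ij : j = i + 1) (jk : k = j + 1) (x : deg i),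
    cdiff jk (cdiff ij x) = 0 }.
Arguments cdiff {K} _ {i j}.

Record cochain_map (K : fieldType) (X Y : cochain K) := CochainMap {
  cmap :> forall i, {linear X i -> Y i};
  cmapE : forall i j (ij : j = i + 1) (x : X i),
    cmap j (cdiff X ij x) = cdiff Y ij (cmap i x) }.

Lemma cochain_map_ext (K : fieldType) (X Y : cochain K) (f g : cochain_map X Y) :
  (forall i, f i =1 g i) -> f = g.
Proof.
case: f g => [f fE] [g gE] /= fg.
have efg : f = g.
  by apply: functional_extensionality_dep => i; apply: linear_ext; apply: fg.
by subst g; rewrite (Prop_irrelevance fE gE).
Qed.

Definition cochain_idmap (K : fieldType) (X : cochain K) : cochain_map X X.
Proof. by exists (fun i => idfun). Defined.

Definition cochain_comp (K : fieldType) (X Y Z : cochain K)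
  (g : cochain_map Y Z) (f : cochain_map X Y) : cochain_map X Z.
Proof.
by exists (fun i => g i \o f i); move=> i j ij x /=; rewrite !cmapE.
Defined.

Definition Ch (K : fieldType) : category.
Proof.
exists (cochain K) (@cochain_map K) (@cochain_idmap K) (@cochain_comp K);
  by move=> *; apply: cochain_map_ext.
Defined.

(* Quotient of V by the subspace I.  The proof that I is closed under
   scaling is an argument of the type so that the module structure can be
   inferred from it. *)

Definition lquot (K : fieldType) (V : lmodType K) (I : zmodClosed V)
  (ZI : GRing.scaler_closed (I : {pred V})) : Type := Quotient.quot I.

Section Lquot.
Context (K : fieldType) (V : lmodType K) (I : zmodClosed V).
Context (ZI : GRing.scaler_closed (I : {pred V})).

HB.instance Definition _ := GRing.Zmodule.copy (lquot ZI) (Quotient.quot I).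

Definition lquot_pi (x : V) : lquot ZI := \pi_(Quotient.quot I) x.

Definition lquot_repr (c : lquot ZI) : V := repr (c : Quotient.quot I).

Definition lquot_scale (a : K) (c : lquot ZI) : lquot ZI :=
  lquot_pi (a *: lquot_repr c).

Lemma lquot_piP (x y : V) : lquot_pi x = lquot_pi y <-> x - y \in I.
Proof. by rewrite Quotient.idealrBE; split=> [/eqP|/eqP]. Qed.

Lemma lquot_reprK : cancel lquot_repr lquot_pi.
Proof. by move=> c; apply: reprK. Qed.

Lemma lquot_ind (P : lquot ZI -> Prop) :
  (forall x, P (lquot_pi x)) -> forall c, P c.
Proof. by move=> h c; rewrite -(lquot_reprK c). Qed.

Lemma lquot_piD (x y : V) : lquot_pi (x + y) = lquot_pi x + lquot_pi y.
Proof. exact: (raddfD (\pi_(Quotient.quot I))). Qed.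

Lemma lquot_repr_pi (x : V) : x - lquot_repr (lquot_pi x) \in I.
Proof. by apply/lquot_piP; rewrite lquot_reprK. Qed.

Lemma lquot_scaleE (a : K) (x : V) :
  lquot_scale a (lquot_pi x) = lquot_pi (a *: x).
Proof. by apply/esym/lquot_piP; rewrite -scalerBr ZI // lquot_repr_pi. Qed.

Fact lquot_scaleA a b (v : lquot ZI) :
  lquot_scale a (lquot_scale b v) = lquot_scale (a * b) v.
Proof. by elim/lquot_ind: v => x; rewrite !lquot_scaleE scalerA. Qed.

Fact lquot_scale1 : left_id 1 lquot_scale.
Proof. by elim/lquot_ind => x; rewrite lquot_scaleE scale1r. Qed.

Fact lquot_scaleDr : right_distributive lquot_scale +%R.
Proof.
move=> a; elim/lquot_ind => x; elim/lquot_ind => y.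
by rewrite -lquot_piD !lquot_scaleE scalerDr lquot_piD.
Qed.

Fact lquot_scaleDl (v : lquot ZI) : {morph lquot_scale^~ v : a b / a + b}.
Proof.
move=> a b; elim/lquot_ind: v => x.
by rewrite !lquot_scaleE scalerDl lquot_piD.
Qed.

HB.instance Definition _ := GRing.Zmodule_isLmodule.Build K (lquot ZI)
  lquot_scaleA lquot_scale1 lquot_scaleDr lquot_scaleDl.

Fact lquot_pi_is_linear : linear lquot_pi.
Proof. by move=> a x y; rewrite lquot_piD -lquot_scaleE. Qed.
HB.instance Definition _ :=
  GRing.isLinear.Build K V (lquot ZI) *:%R lquot_pi lquot_pi_is_linear.

End Lquot.

Section Cohomology.
Context (K : fieldType) (X : cochain K) (k : int).

Definition is_cocycle : pred (X k) := fun x => cdiff X (erefl (k + 1)) x == 0.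

Fact is_cocycle_submod : submod_closed is_cocycle.
Proof.
split=> [|a x y]; first by rewrite unfold_in /is_cocycle raddf0.
rewrite !unfold_in /is_cocycle => /eqP dx /eqP dy.
by rewrite linearP dx dy scaler0 addr0.
Qed.
HB.instance Definition _ := GRing.isSubmodClosed.Build K (X k) is_cocycle
  (GRing.submod_closed_semi is_cocycle_submod).

Record cocycle := Cocycle { cocycle_val :> X k; _ : is_cocycle cocycle_val }.
HB.instance Definition _ := [isSub for cocycle_val].
HB.instance Definition _ := [Choice of cocycle by <:].
HB.instance Definition _ := [SubChoice_isSubLmodule of cocycle by <:].

Definition is_coboundary : pred cocycle :=
  fun z => `[< exists y : X (k - 1), val z = cdiff X (esym (subrK 1 k)) y >].

Fact is_coboundary_submod : submod_closed is_coboundary.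
Proof.
split=> [|a x y]; first by apply/asboolP; exists 0; rewrite !raddf0.
move=> /asboolP[x' ex] /asboolP[y' ey]; apply/asboolP.
by exists (a *: x' + y'); rewrite [RHS]linearP -ex -ey; exact: linearP.
Qed.
HB.instance Definition _ := GRing.isZmodClosed.Build cocycle is_coboundary
  (GRing.submod_closedB is_coboundary_submod).

Definition cohomology : lmodType K :=
  lquot (GRing.subsemimod_closedZ
           (GRing.submod_closed_semi is_coboundary_submod)).

Definition coh_class (z : cocycle) : cohomology := lquot_pi _ z.

Definition coh_rep (c : cohomology) : cocycle := lquot_repr c.

Lemma coh_class_linear : linear coh_class.
Proof. exact: lquot_pi_is_linear. Qed.

Lemma coh_repK : cancel coh_rep coh_class.
Proof. exact: lquot_reprK. Qed.

Lemma coh_classP (z z' : cocycle) :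
  coh_class z = coh_class z' <->
  exists y : X (k - 1), val z - val z' = cdiff X (esym (subrK 1 k)) y.
Proof.
by split=> [/lquot_piP/asboolP|h]; [|apply/lquot_piP/asboolP]; rewrite raddfB.
Qed.

End Cohomology.

Section CohomologyMap.
Context (K : fieldType).

Fact cmap_cocycle (X Y : cochain K) (f : cochain_map X Y) k (z : cocycle X k) :
  is_cocycle (f k (val z)).
Proof. by case: z => x /= /eqP dx; rewrite /is_cocycle -cmapE dx raddf0. Qed.

Definition cocycle_map (X Y : cochain K) (f : cochain_map X Y) k
  (z : cocycle X k) : cocycle Y k := Cocycle (cmap_cocycle f z).

Definition cohomology_map (X Y : cochain K) (f : cochain_map X Y) k
  (c : cohomology X k) : cohomology Y k := coh_class (cocycle_map f (coh_rep c)).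

Lemma cohomology_mapE (X Y : cochain K) (f : cochain_map X Y) k
  (z : cocycle X k) : cohomology_map f (coh_class z) = coh_class (cocycle_map f z).
Proof.
apply/coh_classP; have /coh_classP[y ey] := coh_repK (coh_class z).
by exists (f _ y); rewrite /= -raddfB ey; exact: cmapE.
Qed.

Lemma cohomology_map1 (X : cochain K) k (c : cohomology X k) :
  cohomology_map (cochain_idmap X) c = c.
Proof.
by rewrite -[c]coh_repK cohomology_mapE; congr coh_class; apply: val_inj.
Qed.

Lemma cohomology_mapM (X Y Z : cochain K) (g : cochain_map Y Z)
  (f : cochain_map X Y) k (c : cohomology X k) :
  cohomology_map (cochain_comp g f) c = cohomology_map g (cohomology_map f c).
Proof.
by rewrite -[c]coh_repK !cohomology_mapE; congr coh_class; apply: val_inj.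
Qed.

Fact cohomology_map_linear (X Y : cochain K) (f : cochain_map X Y) k :
  linear (@cohomology_map X Y f k).
Proof.
move=> a c c'; rewrite -(coh_repK c) -(coh_repK c') -coh_class_linear !cohomology_mapE.
rewrite -coh_class_linear; congr coh_class; apply: val_inj.
by rewrite /= !linearP.
Qed.
HB.instance Definition _ (X Y : cochain K) (f : cochain_map X Y) k :=
  GRing.isLinear.Build K (cohomology X k) (cohomology Y k) *:%R
    (@cohomology_map X Y f k) (@cohomology_map_linear X Y f k).

End CohomologyMap.

Definition cohomology_functor (K : fieldType) (k : int) : functor (Ch K) (Vect K).
Proof.
exists (fun X : ob (Ch K) => cohomology X k : ob (Vect K))
  (fun (X Y : ob (Ch K)) (f : hom X Y) =>
     (@cohomology_map K X Y f k : {linear _ -> _})).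
- by move=> X; apply: linear_ext; apply: cohomology_map1.
- by move=> X Y Z g f; apply: linear_ext; apply: cohomology_mapM.
Defined.

Definition quasi_iso (K : fieldType) (X Y : cochain K) (f : cochain_map X Y) :
  Prop := forall k, bijective (@cohomology_map K X Y f k).

Definition weak_equiv (R : realType) (K : fieldType) (X Y : pers R (Ch K))
  (f : nat_trans X Y) : Prop := forall r, quasi_iso (ncomp f r).

Inductive zigzag (R : realType) (K : fieldType) (X : pers R (Ch K)) :
    pers R (Ch K) -> Prop :=
  | zigzag_refl : zigzag X X
  | zigzag_fwd Y Z (f : nat_trans Y Z) :
      zigzag X Y -> weak_equiv f -> zigzag X Z
  | zigzag_bwd Y Z (f : nat_trans Z Y) :
      zigzag X Y -> weak_equiv f -> zigzag X Z.

Definition homotopy_interleaved (R : realType) (K : fieldType)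
  (X Y : pers R (Ch K)) (e : R) : Prop :=
  exists X' Y' : pers R (Ch K),
    [/\ zigzag X X', zigzag Y Y' & interleaved X' Y' e].

Definition d_HI (R : realType) (K : fieldType) (X Y : pers R (Ch K)) : \bar R :=
  ereal_inf [set e%:E | e in [set e : R | homotopy_interleaved X Y e]]%classic.

Record dgmod (K : fieldType) := DgMod {
  dg_cochain :> cochain K;
  uact : forall i j : int, j = i + 2 -> {linear dg_cochain i -> dg_cochain j};
  uact_cdiff : forall i j i' j' (ij : j = i + 1) (ii' : i' = i + 2)
      (jj' : j' = j + 2) (ij' : j' = i' + 1) (x : dg_cochain i),
    uact jj' (cdiff dg_cochain ij x) = cdiff dg_cochain ij' (uact ii' x) }.
Arguments uact {K} _ {i j}.

(* (Sigma^l X)^i = X^(i + l); only even l are used, for which the usual sign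
   (-1)^l of the differential is 1. *)
Fact shift_deg (l i j : int) : j = i + 1 -> j + l = i + l + 1.
Proof. by move->; rewrite addrAC. Qed.

Definition cochain_shift (K : fieldType) (l : int) (X : cochain K) : cochain K.
Proof.
exists (fun i => X (i + l)) (fun i j ij => cdiff X (shift_deg l ij)).
by move=> i j k ij jk x; apply: cdiffK.
Defined.

Section Upow.
Context (K : fieldType) (M : dgmod K).

Fact upow0_deg (i j : int) : j = i + 2 * 0%:Z -> i = j.
Proof. by rewrite mulr0 addr0. Qed.

Fact upowS_deg (n : nat) (i j : int) :
  j = i + 2 * n.+1%:Z -> j = i + 2 + 2 * n%:Z.
Proof. by move->; rewrite intS mulrDr mulr1 addrA. Qed.

Fixpoint upow (n : nat) : forall i j : int, j = i + 2 * n%:Z -> M i -> M j :=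
  if n is n'.+1 then
    fun i j ij x => upow (upowS_deg ij) (uact M (erefl (i + 2)) x)
  else fun i j ij x => ecast m (M m) (upow0_deg ij) x.

Fact upow_linear n i j (ij : j = i + 2 * n%:Z) : linear (upow ij).
Proof.
elim: n => [|n IHn] in i j ij *; last by move=> a x y; rewrite /= linearP IHn.
by move=> a x y /=; case: _ / (upow0_deg ij).
Qed.
HB.instance Definition _ n i j (ij : j = i + 2 * n%:Z) :=
  GRing.isLinear.Build K (M i) (M j) *:%R (upow ij) (upow_linear ij).

Lemma upow_irr m n i j (ij : j = i + 2 * m%:Z) (ij' : j = i + 2 * n%:Z) :
  upow ij =1 upow ij'.
Proof.
have emn : m = n.
  by move: (ij); rewrite {1}ij' => /addrI /(mulfI (isT : 2%:Z != 0)) [].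
by subst n => x; rewrite (eq_irrelevance ij ij').
Qed.

Lemma upow0 i (ii : i = i + 2 * 0%:Z) (x : M i) : upow ii x = x.
Proof. by rewrite /= (eq_irrelevance (upow0_deg ii) (erefl i)). Qed.

Lemma upowD m n i j k (ij : j = i + 2 * m%:Z) (jk : k = j + 2 * n%:Z)
  (ik : k = i + 2 * (m + n)%:Z) (x : M i) : upow ik x = upow jk (upow ij x).
Proof.
elim: m => [|m IHm] in i ij ik x *; last exact: IHm.
rewrite [upow ij x]/=; move: (upow0_deg ij) => {ij} eij; subst j.
exact: (upow_irr ik jk).
Qed.

Lemma upow_diff n i j i' j' (ij : j = i + 1) (ii' : i' = i + 2 * n%:Z)
    (jj' : j' = j + 2 * n%:Z) (ij' : j' = i' + 1) (x : M i) :
  upow jj' (cdiff M ij x) = cdiff M ij' (upow ii' x).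
Proof.
elim: n => [|n IHn] in i j ij ii' jj' x *.
  rewrite /=; move: (upow0_deg ii') (upow0_deg jj') => {ii' jj'} ei ej.
  case: i' / ei ij' => ij'; case: j' / ej ij' => ij'.
  by rewrite /= (eq_irrelevance ij ij').
have ij2 : j + 2 = i + 2 + 1 by rewrite ij addrAC.
by rewrite /= (uact_cdiff _ (erefl (i + 2)) _ ij2); apply: IHn.
Qed.

End Upow.

Section Alpha.
Context (R : realType) (K : fieldType) (M : dgmod K).

Fact alpha_deg (r s : R) (i : int) : r <= s ->
  i + 2 * Num.floor s =
  i + 2 * Num.floor r + 2 * `|Num.floor s - Num.floor r|%N%:Z.
Proof.
move=> rs; rewrite gez0_abs ?subr_ge0 ?le_floor //.
by rewrite -addrA -mulrDr subrKC.
Qed.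

Definition alpha_map (r s : R) (rs : r <= s) :
  cochain_map (cochain_shift (2 * Num.floor r) M)
              (cochain_shift (2 * Num.floor s) M).
Proof.
exists (fun i => upow (alpha_deg i rs) : {linear M _ -> M _}).
by move=> i j ij x /=; apply: upow_diff.
Defined.

Definition alpha : pers R (Ch K).
Proof.
exists (fun r => cochain_shift (2 * Num.floor r) M : ob (Ch K)) alpha_map.
- move=> r rr; apply: cochain_map_ext => i x /=.
  have ii : i + 2 * Num.floor r = i + 2 * Num.floor r + 2 * 0%:Z.
    by rewrite mulr0 addr0.
  by rewrite (upow_irr _ ii) upow0.
- move=> r s t rs st rt; apply: cochain_map_ext => i x /=.
  have ik : i + 2 * Num.floor t = i + 2 * Num.floor r +
      2 * (`|Num.floor s - Num.floor r| + `|Num.floor t - Num.floor s|)%N%:Z.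
    by rewrite PoszD mulrDr addrA -!alpha_deg.
  by rewrite (upow_irr _ ik); apply: upowD.
Defined.

End Alpha.
Arguments alpha R {K} M.

Definition nu (R : realType) (K : fieldType) (k : int) (M : dgmod K) :
  pers R (Vect K) := pers_comp (cohomology_functor K k) (alpha R M).
Arguments nu R {K} k M.

Definition d_CohI (R : realType) (K : fieldType) (k : int) (M N : dgmod K) :
  \bar R := d_I (nu R k M) (nu R k N).
Arguments d_CohI R {K} k M N.

(* Main.v *)
(* Cohomology sends zigzags of weak equivalences to isomorphisms and preserves
   interleavings, which gives one inequality.

   For the other one, alpha M is formal: it is connected by a zigzag to the
   persistent complex X with zero differential and X^i = H^i (alpha M).  Linear
   sections of the cocycles give maps s from X to alpha M that commute with the
   structure maps only up to homotopies h.  Since alpha M only changes at the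
   integers, it can be replaced by the homotopy limit of its values at the
   integers m >= floor r, whose structure maps forget entries and hence are strict; then
   v |-> (s u^(m-n) v, h u^(m-n) v)_m is a strict natural transformation.  By
   2-periodicity H^i (alpha M) is a shift of nu^0 or nu^1, so that interleavings
   of nu^0 and nu^1 assemble, degree by degree, to one of the models X. *)
Require Import Defs.
From HB Require Import structures.
From mathcomp Require Import all_boot all_order all_algebra.
From mathcomp Require Import boolp classical_sets reals constructive_ereal ereal.
(* The imports above shadow [fmap]. *)
Import Defs.
Set Implicit Arguments.
Unset Strict Implicit.
Unset Printing Implicit Defensive.
Import Order.TTheory GRing.Theory Num.Theory.
Local Open Scope ring_scope.

(** * Linear lifts along linear maps of vector spaces *)

Definition to_linear (K : fieldType) (U V : lmodType K) (f : U -> V)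
  (fL : linear f) : {linear U -> V} :=
  HB.pack f (GRing.isLinear.Build K U V *:%R f fL).

Lemma dep_choice (I : Type) (T : I -> Type) (P : forall i, T i -> Prop) :
  (forall i, exists x, P i x) -> exists f : forall i, T i, forall i, P i (f i).
Proof.
by move=> exP; exists (fun i => sval (cid (exP i))) => i; apply: svalP.
Qed.

Section LinearLift.
Context (K : fieldType) (U V W : lmodType K).
Context (g : {linear U -> W}) (f : {linear V -> W}).

(** Partial lifts are encoded by their graphs. The empty graph qualifies, as the union of the empty
    chain must. *)
Let partial_lift (A : set (U * V)%type) : Prop :=
  [/\ forall a p q, A p -> A q -> A (a *: p + q),
      forall u v v', A (u, v) -> A (u, v') -> v = v'
    & forall p, A p -> f p.2 = g p.1].

Let partial_lift_bigcup (F : set (set (U * V)%type)) :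
  (F `<=` partial_lift)%classic -> total_on F subset ->
  partial_lift (\bigcup_(X in F) X)%classic.
Proof.
move=> FP Ftot.
have joint p q : (\bigcup_(X in F) X)%classic p ->
    (\bigcup_(X in F) X)%classic q -> exists2 X, F X & X p /\ X q.
  move=> [X FX Xp] [Y FY Yq].
  by case: (Ftot _ _ FX FY) => s; [exists Y|exists X] => //; split=> //; apply: s.
split.
- move=> a p q /joint h /h[X FX [Xp Xq]]; exists X => //.
  by have [+ _ _] := FP _ FX; apply.
- move=> u v v' /joint h /h[X FX [Xp Xq]]; have [_ s _] := FP _ FX.
  exact: (s _ _ _ Xp Xq).
- by move=> p [X FX Xp]; have [_ _] := FP _ FX; apply.
Qed.

(* Vector spaces are projective; a lift is a maximal partial lift, whose domain
   is everything because a new vector can be sent to any of its preimages. *)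
Lemma linear_lift :
  (forall u, exists v, f v = g u) -> exists h : {linear U -> V}, forall u, f (h u) = g u.
Proof.
move=> gf; have [A [[Alin Afun Afg] Amax]] := Zorn_bigcup partial_lift_bigcup.
(* The singleton of 0 properly extends the empty graph, so a maximal graph is nonempty and, being
   closed under linear combinations, contains 0. *)
have A0 : A 0.
  have [[p Ap]|An] := pselect (exists p, A p).
    by have := Alin (-1) _ _ Ap Ap; rewrite scaleN1r addNr.
  exfalso; apply: (Amax [set 0]%classic).
    split; first by move=> p Ap; case: An; exists p.
    by move=> s; apply: An; exists 0; apply: s.
  split=> [a p q -> ->|u v v' [_ ->] [_ ->]|p ->] //=; first by rewrite scaler0 addr0.
  by rewrite !linear0.
have Aker v : A (0, v) -> v = 0 by move=> A0v; apply: Afun A0v A0.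
have Atot u : exists v, A (u, v).
  apply: contrapT => Au; have [v fv] := gf u.
  (* [B] is spanned by [A] and the new pair [(u, v)]. If [q + c *: (u, v)] has first entry 0 with
     nonzero [c], then [u] is a multiple of the first entry of [q] and already lies in the domain of
     [A]. *)
  pose B := [set p | exists2 q, A q & exists c, p = q + c *: (u, v)]%classic.
  have AB p : A p -> B p by move=> Ap; exists p => //; exists 0; rewrite scale0r addr0.
  have Bker w : B (0, w) -> w = 0.
    move=> [[q1 q2] Aq [c [e1 e2]]]; have [c0|c0] := eqVneq c 0.
      by move: e1 e2 Aq; rewrite c0 !scale0r !addr0 => <- <- /Aker.
    exfalso; apply: Au; exists (- c^-1 *: q2).
    have := Alin (- c^-1) _ _ Aq A0; rewrite addr0.
    have -> : u = - c^-1 *: q1; last by [].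
    have -> : q1 = - (c *: u) by apply/eqP; rewrite -addr_eq0 -e1.
    by rewrite scaleNr scalerN opprK scalerA mulVf ?scale1r.
  have Blin a p q : B p -> B q -> B (a *: p + q).
    move=> [p' Ap [c ->]] [q' Aq [d ->]]; exists (a *: p' + q'); first exact: Alin.
    by exists (a * c + d); rewrite scalerDr scalerA scalerDl addrACA.
  apply: (Amax B); first split=> //.
    move=> s; apply: Au; exists v; apply: s; exists 0 => //.
    by exists 1; rewrite scale1r add0r.
  split=> //.
    move=> w x x' Bx Bx'; apply/eqP; rewrite -subr_eq0; apply/eqP/Bker.
    have := Blin (-1) _ _ Bx' Bx.
    by rewrite scaleN1r; congr B; congr pair; rewrite /= addrC ?subrr.
  by move=> _ [p Ap [c ->]] /=; rewrite !linearD !linearZ /= fv Afg.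
have [h Ah] := choice Atot.
have hL : linear h.
  by move=> a u w; apply: Afun (Ah _) _; exact: (Alin a (u, h u) (w, h w)).
by exists (to_linear hL) => u; apply: Afg (Ah u).
Qed.

End LinearLift.

Lemma bij_linear_inv (K : fieldType) (U V : lmodType K) (f : {linear U -> V}) :
  bijective f -> exists2 g : {linear V -> U}, cancel f g & cancel g f.
Proof.
move=> [g fK gK]; have gL : linear g.
  by move=> a u v; apply: (can_inj fK); rewrite linearP !gK.
by exists (to_linear gL).
Qed.

(** * Interleavings under isomorphism, enlargement of the parameter and shift *)

Section Interleavings.
Context (R : realType) (C : category).
Implicit Types F G H : pers R C.

Lemma pmor_irr F r s (rs rs' : r <= s) : pmor F rs = pmor F rs'.
Proof. by rewrite (bool_irrelevance rs rs'). Qed.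

Lemma compm_pmor F r s t (rs : r <= s) (st : s <= t) :
  compm (pmor F st) (pmor F rs) = pmor F (le_trans rs st).
Proof. exact/esym/pmorM. Qed.

Definition nat_comp F G H (g : nat_trans G H) (f : nat_trans F G) : nat_trans F H.
Proof.
exists (fun r => compm (ncomp g r) (ncomp f r)) => r s rs.
by rewrite -compmA natural compmA natural compmA.
Defined.

Definition nat_shift F G (f : nat_trans F G) e :
  nat_trans (pers_shift F e) (pers_shift G e).
Proof. by exists (fun r => ncomp f (r + e)) => r s rs /=; rewrite natural. Defined.

Definition pers_iso F G : Prop :=
  exists (f : nat_trans F G) (g : nat_trans G F),
    (forall r, compm (ncomp g r) (ncomp f r) = idm (pob F r)) /\
    (forall r, compm (ncomp f r) (ncomp g r) = idm (pob G r)).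

Lemma pers_iso_refl F : pers_iso F F.
Proof.
have @i : nat_trans F F.
  by exists (fun r => idm _) => r s rs; rewrite comp1m compm1.
by exists i, i; split=> r /=; rewrite comp1m.
Qed.

Lemma pers_iso_sym F G : pers_iso F G -> pers_iso G F.
Proof. by move=> [f [g [gf fg]]]; exists g, f. Qed.

Lemma pers_iso_trans F G H : pers_iso F G -> pers_iso G H -> pers_iso F H.
Proof.
move=> [f [f' [ff' f'f]]] [g [g' [gg' g'g]]].
exists (nat_comp g f), (nat_comp f' g'); split=> r /=.
  by rewrite -compmA (compmA (ncomp g' r)) gg' comp1m ff'.
by rewrite -compmA (compmA (ncomp f r)) f'f comp1m g'g.
Qed.

Lemma interleaved_iso F F' G G' e :
  pers_iso F F' -> pers_iso G G' -> interleaved F G e -> interleaved F' G' e.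
Proof.
move=> [f [f' [ff' f'f]]] [g [g' [gg' g'g]]] [e0 [phi [psi [psiphi phipsi]]]].
exists e0, (nat_comp (nat_shift g e) (nat_comp phi f')).
exists (nat_comp (nat_shift f e) (nat_comp psi g')); split=> r /=.
  rewrite -compmA -(compmA (ncomp psi _)) (compmA (ncomp g' _)) gg' comp1m.
  by rewrite (compmA (ncomp psi _)) psiphi compmA natural -compmA f'f compm1.
rewrite -compmA -(compmA (ncomp phi _)) (compmA (ncomp f' _)) ff' comp1m.
by rewrite (compmA (ncomp phi _)) phipsi compmA natural -compmA g'g compm1.
Qed.

(** Both maps are composed with structure maps. Interleavings of [nu] in degrees 0 and 1, found at
    different parameters, can thus be brought to a common one. *)
Lemma interleaved_le F G e e' : e <= e' -> interleaved F G e -> interleaved F G e'.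
Proof.
move=> ee' [e0 [phi [psi [psiphi phipsi]]]].
have widen (r : R) : r + e <= r + e' by rewrite lerD2l.
have @wid H : nat_trans (pers_shift H e) (pers_shift H e').
  exists (fun r => pmor H (widen r)) => r s rs /=.
  by rewrite !compm_pmor; apply: pmor_irr.
exists (le_trans e0 ee'), (nat_comp (wid G) phi), (nat_comp (wid F) psi).
split=> r /=.
  rewrite -compmA (compmA (ncomp psi _)) (natural psi) -compmA psiphi.
  by rewrite !compm_pmor; apply: pmor_irr.
rewrite -compmA (compmA (ncomp phi _)) (natural phi) -compmA phipsi.
by rewrite !compm_pmor; apply: pmor_irr.
Qed.

Lemma interleaved_shift F G m e :
  interleaved F G e -> interleaved (pers_shift F m) (pers_shift G m) e.
Proof.
move=> [e0 [phi [psi [psiphi phipsi]]]].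
(* [r + m + e] and [r + e + m] are equal but not convertible; a structure map between them replaces
   a transport. *)
have sw (r : R) : r + m + e <= r + e + m by rewrite addrAC.
have @swp H : nat_trans (pers_shift (pers_shift H e) m) (pers_shift (pers_shift H m) e).
  exists (fun r => pmor H (sw r)) => r s rs /=.
  by rewrite !compm_pmor; apply: pmor_irr.
exists e0, (nat_comp (swp G) (nat_shift phi m)), (nat_comp (swp F) (nat_shift psi m)).
split=> r /=.
  rewrite -compmA (compmA (ncomp psi _)) (natural psi) -compmA psiphi.
  by rewrite !compm_pmor; apply: pmor_irr.
rewrite -compmA (compmA (ncomp phi _)) (natural phi) -compmA phipsi.
by rewrite !compm_pmor; apply: pmor_irr.
Qed.

End Interleavings.

(** * Interleavings and zigzags on cohomology *)

Lemma interleaved_comp (R : realType) (C D : category) (T : functor C D)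
  (F G : pers R C) e :
  interleaved F G e -> interleaved (pers_comp T F) (pers_comp T G) e.
Proof.
move=> [e0 [phi [psi [psiphi phipsi]]]]; exists e0.
have Tnat (F' G' : pers R C) (f : nat_trans F' (pers_shift G' e)) r s (rs : r <= s) :
    compm (fmap T (ncomp f s)) (fmap T (pmor F' rs)) =
    compm (fmap T (pmor G' (le_shift e rs))) (fmap T (ncomp f r)).
  by rewrite -!fmapM natural.
exists (NatTrans (F := pers_comp T F) (G := pers_shift (pers_comp T G) e)
  (Tnat _ _ phi)).
exists (NatTrans (F := pers_comp T G) (G := pers_shift (pers_comp T F) e)
  (Tnat _ _ psi)).
by split=> r /=; rewrite -fmapM ?psiphi ?phipsi.
Qed.

Section Cohomology.
Context (R : realType) (K : fieldType).
Implicit Types X Y : pers R (Ch K).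

(** Pointwise inverses of a natural map are automatically natural. *)
Lemma weak_equiv_pers_iso X Y (f : nat_trans X Y) k : weak_equiv f ->
  pers_iso (pers_comp (cohomology_functor K k) X)
           (pers_comp (cohomology_functor K k) Y).
Proof.
move=> fW; pose H := cohomology_functor K k.
have fnat r s (rs : r <= s) : compm (fmap H (ncomp f s)) (fmap H (pmor X rs)) =
    compm (fmap H (pmor Y rs)) (fmap H (ncomp f r)).
  by rewrite -!fmapM natural.
have gex r : exists g : hom (fob H (pob Y r)) (fob H (pob X r)),
    compm g (fmap H (ncomp f r)) = idm _ /\ compm (fmap H (ncomp f r)) g = idm _.
  have [g fK gK] := bij_linear_inv (f := fmap H (ncomp f r)) (fW r k).
  by exists g; split; apply: linear_ext.
have [g gP] := dep_choice gex.
have gnat r s (rs : r <= s) :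
    compm (g s) (fmap H (pmor Y rs)) = compm (fmap H (pmor X rs)) (g r).
  rewrite -[fmap H (pmor Y rs)]compm1 -(gP r).2 (compmA (fmap H _)) -fnat.
  by rewrite !compmA (gP s).1 comp1m.
exists (NatTrans (F := pers_comp H X) (G := pers_comp H Y) fnat).
exists (NatTrans (F := pers_comp H Y) (G := pers_comp H X) gnat).
by split=> r /=; have [] := gP r.
Qed.

Lemma zigzag_pers_iso X Y k : zigzag X Y ->
  pers_iso (pers_comp (cohomology_functor K k) X)
           (pers_comp (cohomology_functor K k) Y).
Proof.
elim=> [|Y' Z f _ XY' fW|Y' Z f _ XY' fW]; first exact: pers_iso_refl.
  exact: pers_iso_trans XY' (weak_equiv_pers_iso k fW).
exact: pers_iso_trans XY' (pers_iso_sym (weak_equiv_pers_iso k fW)).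
Qed.

(** For [k] equal to 0 and 1 this bounds each [d_CohI] by [d_HI]. *)
Lemma homotopy_interleaved_cohomology X Y k e : homotopy_interleaved X Y e ->
  interleaved (pers_comp (cohomology_functor K k) X)
              (pers_comp (cohomology_functor K k) Y) e.
Proof.
move=> [X' [Y' [XX' YY' /(interleaved_comp (cohomology_functor K k))]]].
by apply: interleaved_iso; apply/pers_iso_sym/zigzag_pers_iso.
Qed.

End Cohomology.

(** * Casts between equal degrees, and quasi-isomorphisms in terms of cocycles *)

Section Cochains.
Context (K : fieldType).
Implicit Types X Y Z : cochain K.

(** The identity map is cast rather than its values, so that linearity holds by construction. *)
Definition ccast X i j (e : i = j) : {linear X i -> X j} :=
  ecast n {linear X i -> X n} e idfun.

Lemma ccast_id X i (e : i = i) (x : X i) : ccast X e x = x.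
Proof. by rewrite (eq_irrelevance e (erefl i)). Qed.

Lemma ccast_comp X i j k (ij : i = j) (jk : j = k) (ik : i = k) (x : X i) :
  ccast X jk (ccast X ij x) = ccast X ik x.
Proof. by subst j k; rewrite !ccast_id. Qed.

Lemma ccastKV X i j (e : i = j) (x : X j) : ccast X e (ccast X (esym e) x) = x.
Proof. by case: j / e x => x. Qed.

Lemma cdiff_ccast X i i' j (e : i = i') (ij : j = i' + 1) (ij' : j = i + 1)
  (x : X i) : cdiff X ij (ccast X e x) = cdiff X ij' x.
Proof. by subst i'; rewrite ccast_id (eq_irrelevance ij ij'). Qed.

Lemma ccast_cdiff X i j j' (e : j = j') (ij : j = i + 1) (ij' : j' = i + 1)
  (x : X i) : ccast X e (cdiff X ij x) = cdiff X ij' x.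
Proof. by subst j'; rewrite ccast_id (eq_irrelevance ij ij'). Qed.

Definition closed X i (x : X i) : Prop :=
  forall j (ij : j = i + 1), cdiff X ij x = 0.

Definition cobounds X i (x : X i) : Prop :=
  exists j (ij : i = j + 1) (y : X j), x = cdiff X ij y.

Lemma closedE X i j (ij : j = i + 1) (x : X i) : cdiff X ij x = 0 -> closed x.
Proof.
by move=> dx k ik; rewrite -(ccast_cdiff (etrans ij (esym ik)) ij) dx linear0.
Qed.

Lemma cobounds_cdiff X i j (ij : j = i + 1) (y : X i) : cobounds (cdiff X ij y).
Proof. by exists i, ij, y. Qed.

Lemma cobounds_at X i j (ij : i = j + 1) (x : X i) :
  cobounds x -> exists y : X j, x = cdiff X ij y.
Proof.
move=> [j' [ij' [y ->]]]; have e : j' = j by apply: (addIr 1); rewrite -ij'.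
by exists (ccast X e y); rewrite (cdiff_ccast _ _ ij').
Qed.

Lemma cobounds0 X i : cobounds (0 : X i).
Proof. by exists (i - 1), (esym (subrK 1 i)), 0; rewrite linear0. Qed.

Lemma cobounds_ccast X i j (e : i = j) (x : X i) :
  cobounds (ccast X e x) <-> cobounds x.
Proof. by subst j; rewrite ccast_id. Qed.

Lemma closed_ccast X i j (e : i = j) (x : X i) :
  closed (ccast X e x) <-> closed x.
Proof. by subst j; rewrite ccast_id. Qed.

Lemma closed_cmap X Y (f : cochain_map X Y) i (x : X i) :
  closed x -> closed (f i x).
Proof. by move=> dx j ij; rewrite -cmapE dx linear0. Qed.

Lemma cobounds_cmap X Y (f : cochain_map X Y) i (x : X i) :
  cobounds x -> cobounds (f i x).
Proof. by move=> [j [ij [y ->]]]; rewrite cmapE; apply: cobounds_cdiff. Qed.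

Lemma cocycle_closed X i (z : cocycle X i) : closed (val z).
Proof. by case: z => x dx; apply: (closedE (eqP dx)). Qed.

Lemma closed_cocycle X i (x : X i) : closed x -> exists z : cocycle X i, val z = x.
Proof. by move=> dx; exists (Cocycle (introT eqP (dx _ erefl))). Qed.

Lemma coh_class_eq X i (z z' : cocycle X i) :
  coh_class z = coh_class z' <-> cobounds (val z - val z').
Proof.
rewrite coh_classP; split=> [[y ->]|/(cobounds_at (esym (subrK 1 i)))//].
exact: cobounds_cdiff.
Qed.

Lemma coh_ind X i (P : cohomology X i -> Prop) :
  (forall z, P (coh_class z)) -> forall c, P c.
Proof. by move=> Pz c; rewrite -(coh_repK c). Qed.

(** The two clauses are surjectivity and injectivity on cohomology, phrased for cocycles so that
    later arguments avoid quotients. *)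
Lemma quasi_isoP X Y (f : cochain_map X Y) :
  quasi_iso f <->
  (forall i (y : Y i), closed y -> exists2 x, closed x & cobounds (y - f i x)) /\
  (forall i (x : X i), closed x -> cobounds (f i x) -> cobounds x).
Proof.
split=> [fq|[fsurj finj] i].
  split=> i.
    move=> y /closed_cocycle[z <-]; have [g fK gK] := fq i.
    exists (val (coh_rep (g (coh_class z)))); first exact: cocycle_closed.
    apply/(coh_class_eq z (cocycle_map f _)).
    by rewrite -cohomology_mapE coh_repK gK.
  move=> x /closed_cocycle[z <-] fz.
  have : cohomology_map f (coh_class z) = cohomology_map f (coh_class 0).
    by rewrite !cohomology_mapE; apply/coh_class_eq; rewrite /= !linear0 addr0.
  by move/(bij_inj (fq i))/coh_class_eq; rewrite raddf0 addr0.
have fi : injective (@cohomology_map K X Y f i).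
  elim/coh_ind => z; elim/coh_ind => z'; rewrite !cohomology_mapE => /coh_class_eq.
  move=> fzz'; apply/coh_class_eq; apply: finj; last by rewrite linearB.
  by move=> j ij; rewrite linearB !cocycle_closed subrr.
have gex (c : cohomology Y i) : exists c', cohomology_map f c' = c.
  rewrite -(coh_repK c); move: (coh_rep c) => z.
  have [x /closed_cocycle[z' <-] zz'] := fsurj i _ (cocycle_closed z).
  by exists (coh_class z'); rewrite cohomology_mapE; apply/esym/coh_class_eq.
have [g gP] := choice gex.
by exists g => // c; apply: fi.
Qed.

Lemma quasi_iso_bij X Y (f : cochain_map X Y) :
  (forall i, bijective (f i)) -> quasi_iso f.
Proof.
move=> fb; apply/quasi_isoP; split=> i => [y dy|x dx [j [ij [y ey]]]].
  have [g fK gK] := fb i; exists (g y); last by rewrite gK subrr; apply: cobounds0.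
  move=> j ij; apply: (bij_inj (fb j)); rewrite cmapE gK dy linear0 //.
have [g fK gK] := fb j; exists j, ij, (g y).
by apply: (bij_inj (fb i)); rewrite cmapE gK.
Qed.

(** For surjectivity, choose [x] with [g y] cohomologous to [gf x]; injectivity of [g] on cohomology
    then makes [y] cohomologous to [f x]. The map [gf] is compared pointwise, so it can be a simpler
    map than the literal composite. *)
Lemma quasi_iso_cancel X Y Z (g : cochain_map Y Z) (f : cochain_map X Y)
  (gf : cochain_map X Z) : (forall i x, g i (f i x) = gf i x) ->
  quasi_iso g -> quasi_iso gf -> quasi_iso f.
Proof.
move=> gfE /quasi_isoP[gsurj ginj] /quasi_isoP[gfsurj gfinj].
apply/quasi_isoP; split=> i.
  move=> y dy; have [x dx gx] := gfsurj i _ (closed_cmap g dy).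
  exists x => //; apply: ginj; last by rewrite linearB gfE.
  by move=> j ij; rewrite linearB dy (closed_cmap f dx) subrr.
by move=> x dx /(cobounds_cmap g); rewrite gfE; apply: gfinj.
Qed.

End Cochains.

(** * Products of vector spaces over arbitrary index types, and pairs *)

Definition dprod (K : fieldType) (I : Type) (V : I -> lmodType K) : Type :=
  forall i, V i.

Section Dprod.
Context (K : fieldType) (I : Type) (V : I -> lmodType K).
Implicit Types f g h : dprod V.

HB.instance Definition _ := Choice.copy (dprod V) (forall i, V i).

Let add f g : dprod V := fun i => f i + g i.
Let opp f : dprod V := fun i => - f i.
Let zero : dprod V := fun=> 0.
Let scale a f : dprod V := fun i => a *: f i.

Fact dprod_addA : associative add.
Proof. by move=> f g h; apply: functional_extensionality_dep => i; apply: addrA. Qed.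
Fact dprod_addC : commutative add.
Proof. by move=> f g; apply: functional_extensionality_dep => i; apply: addrC. Qed.
Fact dprod_add0 : left_id zero add.
Proof. by move=> f; apply: functional_extensionality_dep => i; apply: add0r. Qed.
Fact dprod_addN : left_inverse zero opp add.
Proof. by move=> f; apply: functional_extensionality_dep => i; apply: addNr. Qed.
HB.instance Definition _ := GRing.isZmodule.Build (dprod V)
  dprod_addA dprod_addC dprod_add0 dprod_addN.

Fact dprod_scaleA a b f : scale a (scale b f) = scale (a * b) f.
Proof. by apply: functional_extensionality_dep => i; apply: scalerA. Qed.
Fact dprod_scale1 : left_id 1 scale.
Proof. by move=> f; apply: functional_extensionality_dep => i; apply: scale1r. Qed.
Fact dprod_scaleDr : right_distributive scale +%R.
Proof. by move=> a f g; apply: functional_extensionality_dep => i; apply: scalerDr. Qed.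
Fact dprod_scaleDl f : {morph scale^~ f : a b / a + b}.
Proof. by move=> a b; apply: functional_extensionality_dep => i; apply: scalerDl. Qed.
HB.instance Definition _ := GRing.Zmodule_isLmodule.Build K (dprod V)
  dprod_scaleA dprod_scale1 dprod_scaleDr dprod_scaleDl.

Fact dprod_proj_linear i : linear (fun f : dprod V => f i).
Proof. by []. Qed.

Definition dprod_proj i : {linear dprod V -> V i} := to_linear (@dprod_proj_linear i).

Context (U : lmodType K) (h : forall i, {linear U -> V i}).

Fact dprod_lift_linear : linear (fun u => (fun i => h i u) : dprod V).
Proof.
by move=> a u v; apply: functional_extensionality_dep => i; apply: linearP.
Qed.

Definition dprod_lift : {linear U -> dprod V} := to_linear dprod_lift_linear.

End Dprod.

Section Pair.
Context (K : fieldType) (U V W : lmodType K).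

Fact fst_linear : linear (@fst V W). Proof. by []. Qed.
Definition linear_fst : {linear (V * W)%type -> V} := to_linear fst_linear.

Fact snd_linear : linear (@snd V W). Proof. by []. Qed.
Definition linear_snd : {linear (V * W)%type -> W} := to_linear snd_linear.

Context (f : {linear U -> V}) (g : {linear U -> W}).

Fact linear_pair_linear : linear (fun u => (f u, g u)).
Proof. by move=> a u v; rewrite !linearP. Qed.
Definition linear_pair : {linear U -> (V * W)%type} := to_linear linear_pair_linear.

End Pair.

(** * Recursion and induction on the integers from [n] on *)

Section IntegersFrom.
Context (n : int).

Definition from : Type := {m : int | n <= m}.

Definition from0 : from := exist _ n (lexx n).

Fact from_succ_le (m : from) : n <= sval m + 1.
Proof. by case: m => m nm /=; apply: le_trans nm _; rewrite lerDl. Qed.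

Definition from_succ (m : from) : from := exist _ (sval m + 1) (from_succ_le m).

Lemma from_eq (l m : from) : sval l = sval m -> l = m.
Proof.
case: l m => [l nl] [m nm] /= lm; subst m.
by rewrite (bool_irrelevance nl nm).
Qed.

Lemma from_irr (V : int -> Type) (x : forall m : from, V (sval m)) (m : int)
  (nm nm' : n <= m) : x (exist _ m nm) = x (exist _ m nm').
Proof. by rewrite (bool_irrelevance nm nm'). Qed.

Definition from_nth (k : nat) : from := iter k from_succ from0.

Lemma sval_from_nth k : sval (from_nth k) = n + k%:Z.
Proof. by elim: k => [|k IHk] /=; rewrite ?addr0 // IHk -addrA -PoszD addn1. Qed.

Lemma from_nthK (m : from) : from_nth `|sval m - n|%N = m.
Proof.
apply: from_eq; rewrite sval_from_nth gez0_abs ?subrKC //.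
by rewrite subr_ge0 (svalP m).
Qed.

(** The family is defined by recursion on the natural number [m - n] and transported along
    [from_nthK]; both equations hold after removing the transport by proof irrelevance. *)
Lemma from_rec (V : from -> Type) (v0 : V from0)
    (step : forall m, V m -> V (from_succ m)) :
  exists a : forall m, V m,
    a from0 = v0 /\ forall m, a (from_succ m) = step m (a m).
Proof.
pose f := fix f k : V (from_nth k) :=
  if k is k'.+1 then step _ (f k') else v0.
pose a m := eq_rect _ V (f `|sval m - n|%N) m (from_nthK m).
have aE k : a (from_nth k) = f k.
  have kE : `|sval (from_nth k) - n|%N = k by rewrite sval_from_nth addrC addKr.
  rewrite /a; move: (from_nthK _); rewrite kE => e.
  by rewrite (Prop_irrelevance e erefl).
exists a; split; first exact: (aE 0).
move=> m; rewrite -(from_nthK m); move: `|_|%N => k.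
by rewrite (aE k) (aE k.+1).
Qed.

Lemma from_ind (P : from -> Prop) :
  P from0 -> (forall m, P m -> P (from_succ m)) -> forall m, P m.
Proof.
move=> P0 PS m; rewrite -(from_nthK m).
by elim: `|_|%N => [|k Pk] //; apply: PS.
Qed.

End IntegersFrom.

Definition from_widen (n n' : int) (nn' : n <= n') (m : from n') : from n :=
  exist _ (sval m) (le_trans nn' (svalP m)).

(** * The homotopy limit of the values at integers *)

Section Floor.
Context (R : realType) (C : category).

Fact ler_intr (l m : int) : l <= m -> l%:~R <= m%:~R :> R.
Proof. by rewrite ler_int. Qed.

(* Quasi-isomorphic to F when F is constant on the intervals [n, n + 1); only
   F (floor r), and not F r, maps to all F m with floor r <= m. *)
Definition pers_floor (F : pers R C) : pers R C.
Proof.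
exists (fun r => pob F (Num.floor r)%:~R) (fun r s rs => pmor F (ler_intr (le_floor rs))).
- by move=> r rr; apply: pmor1.
- by move=> r s t rs st rt; apply: pmorM.
Defined.

Definition pers_floor_map (F : pers R C) : nat_trans (pers_floor F) F.
Proof.
exists (fun r => pmor F (floor_le r)) => r s rs /=.
by rewrite !compm_pmor; apply: pmor_irr.
Defined.

End Floor.

Section Rectification.
Context (R : realType) (K : fieldType) (F : pers R (Ch K)).

Definition at_int (G : pers R (Ch K)) (m : int) : cochain K := pob G m%:~R.

Definition int_map (G : pers R (Ch K)) (l m : int) (lm : l <= m) :
  cochain_map (at_int G l) (at_int G m) := pmor G (ler_intr R lm).

Lemma int_mapM G (l m n : int) (lm : l <= m) (mn : m <= n) (ln : l <= n) i
  (x : at_int G l i) : int_map G mn i (int_map G lm i x) = int_map G ln i x.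
Proof. by rewrite /int_map (pmorM G (ler_intr R lm) (ler_intr R mn)). Qed.

Fact le_succ (m : int) : m <= m + 1. Proof. by rewrite lerDl. Qed.

Fact pred_deg (i j : int) : j = i + 1 -> i = j - 1.
Proof. by move=> ->; rewrite addrK. Qed.

Fact succ_pred_deg (i j : int) : j = i + 1 -> j - 1 = i - 1 + 1.
Proof. by move=> ->; rewrite addrK subrK. Qed.

(* Cochains of the homotopy limit of F n -> F (n + 1) -> ...: a family x_m in
   F m together with homotopies y_m in F (m + 1) from u x_m to x_(m + 1). *)
Definition holim_deg (n i : int) : lmodType K :=
  (dprod (fun m : from n => at_int F (sval m) i) *
   dprod (fun m : from n => at_int F (sval m + 1) (i - 1)))%type.

Definition holim_fst n i (m : from n) : {linear holim_deg n i -> at_int F (sval m) i} :=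
  dprod_proj _ m \o linear_fst _ _.

Definition holim_snd n i (m : from n) :
    {linear holim_deg n i -> at_int F (sval m + 1) (i - 1)} :=
  dprod_proj _ m \o linear_snd _ _.

(** The mapping fibre of [u - shift] between the two products: the sign on the last summand makes
    the square vanish. In a cocycle, [d y_m = u x_m - x_(m+1)]. *)
Definition holim_diff n i j (ij : j = i + 1) : {linear holim_deg n i -> holim_deg n j} :=
  linear_pair
    (dprod_lift (fun m => cdiff (at_int F (sval m)) ij \o holim_fst i m))
    (dprod_lift (fun m =>
      ccast (at_int F (sval m + 1)) (pred_deg ij) \o
        ((int_map F (le_succ (sval m)) i \o holim_fst i m) \- holim_fst i (from_succ m))
      \- (cdiff (at_int F (sval m + 1)) (succ_pred_deg ij) \o holim_snd i m))).

Lemma holim_eq n i (p q : holim_deg n i) :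
  (forall m, p.1 m = q.1 m) -> (forall m, p.2 m = q.2 m) -> p = q.
Proof.
by case: p q => [p1 p2] [q1 q2] /= e1 e2; congr pair;
  apply: functional_extensionality_dep.
Qed.

Lemma holim_diff1 n i j (ij : j = i + 1) p m :
  (@holim_diff n i j ij p).1 m = cdiff (at_int F (sval m)) ij (p.1 m).
Proof. by []. Qed.

Lemma holim_diff2 n i j (ij : j = i + 1) p m :
  (@holim_diff n i j ij p).2 m =
    ccast (at_int F (sval m + 1)) (pred_deg ij)
      (int_map F (le_succ (sval m)) i (p.1 m) - p.1 (from_succ m))
    - cdiff (at_int F (sval m + 1)) (succ_pred_deg ij) (p.2 m).
Proof. by []. Qed.

Fact holim_diffK n i j k (ij : j = i + 1) (jk : k = j + 1) (p : holim_deg n i) :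
  holim_diff n jk (holim_diff n ij p) = 0.
Proof.
apply: holim_eq => m; first by rewrite !holim_diff1; apply: cdiffK.
have ki : k - 1 = i + 1 by rewrite jk addrK.
rewrite holim_diff2 !holim_diff1 holim_diff2.
rewrite (linearB (cdiff _ (succ_pred_deg jk))) /= cdiffK subr0.
rewrite cmapE -linearB (ccast_cdiff _ _ ki) (cdiff_ccast _ _ ki).
exact: subrr.
Qed.

Definition holim_at (n : int) : cochain K := Cochain (@holim_diffK n).

Definition holim_restr_fun (n n' : int) (nn' : n <= n') i :
    {linear holim_deg n i -> holim_deg n' i} :=
  linear_pair (dprod_lift (fun m => holim_fst i (from_widen nn' m)))
              (dprod_lift (fun m => holim_snd i (from_widen nn' m))).

Definition holim_restr (n n' : int) (nn' : n <= n') :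
  cochain_map (holim_at n) (holim_at n').
Proof.
exists (holim_restr_fun nn') => i j ij p; apply: holim_eq => m //=.
(* Both sides contain the entry at [m + 1], but with different proofs of the lower bound on that
   index. *)
by congr (ccast _ _ (_ - _) - _); exact: (from_irr (V := fun l => at_int F l i) p.1).
Defined.

Fact holim_restr1 (r : int) (rr : r <= r) : holim_restr rr = cochain_idmap (holim_at r).
Proof.
apply: cochain_map_ext => i p; apply: holim_eq => -[m rm] /=.
  exact: (from_irr (V := fun l => at_int F l i) p.1).
exact: (from_irr (V := fun l => at_int F (l + 1) (i - 1)) p.2).
Qed.

Fact holim_restrM (r s t : int) (rs : r <= s) (st : s <= t) (rt : r <= t) :
  holim_restr rt = cochain_comp (holim_restr st) (holim_restr rs).
Proof.
apply: cochain_map_ext => i p; apply: holim_eq => m /=.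
  exact: (from_irr (V := fun l => at_int F l i) p.1).
exact: (from_irr (V := fun l => at_int F (l + 1) (i - 1)) p.2).
Qed.

Definition holim : pers R (Ch K) := @Pers R (Ch K)
  (fun r => holim_at (Num.floor r)) (fun r s rs => holim_restr (le_floor rs))
  (fun r rr => holim_restr1 (le_floor rr))
  (fun r s t rs st rt => holim_restrM (le_floor rs) (le_floor st) (le_floor rt)).
End Rectification.

(** * Projection from the homotopy limit and diagonal map into it *)

Section RectificationMaps.
Context (R : realType) (K : fieldType) (F : pers R (Ch K)).

Definition holim_proj (n : int) : cochain_map (holim_at F n) (at_int F n).
Proof. by exists (fun i => holim_fst F i (from0 n)). Defined.

(** Write [p] as [(x, y)] with [x_n = d w]. Set [a_n = w] and [a_(m+1) = u a_m - y_m]; since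
    [d y_m = u x_m - x_(m+1)], induction gives [d a_m = x_m], and the differential of [(a, 0)] is
    [p]. *)
Lemma holim_proj_inj n i (p : holim_at F n i) :
  closed p -> cobounds (holim_proj n i p) -> cobounds p.
Proof.
move=> dp [j [ij [w pw]]].
have ej : i - 1 = j by rewrite ij addrK.
have dp2 m : int_map F (le_succ (sval m)) i (p.1 m) - p.1 (from_succ m) =
    cdiff (at_int F (sval m + 1)) ij (ccast _ ej (p.2 m)).
  have := congr1 (fun q => q.2 m) (dp _ (erefl (i + 1))).
  rewrite holim_diff2 => /eqP; rewrite subr_eq0 => /eqP.
  move/(congr1 (ccast (at_int F (sval m + 1)) (addrK 1 i))).
  rewrite (ccast_comp _ _ (erefl i)) ccast_id => ->.
  rewrite (cdiff_ccast _ _ (esym (subrK 1 i))); exact: ccast_cdiff.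
have [a [a0 aS]] := from_rec (V := fun m => at_int F (sval m) j) w
  (fun m x => int_map F (le_succ (sval m)) j x - ccast _ ej (p.2 m)).
have da m : cdiff (at_int F (sval m)) ij (a m) = p.1 m.
  elim/from_ind: m => [|m IHm]; first by rewrite a0.
  by rewrite aS linearB -cmapE IHm -dp2 subKr.
exists j, ij, (a, 0); apply: holim_eq => m; first by rewrite -da.
rewrite [RHS]holim_diff2 /= aS subKr linear0 subr0.
by rewrite (ccast_comp _ _ (erefl _)) ccast_id.
Qed.

Definition holim_diag_fun n i :=
  linear_pair (dprod_lift (fun m : from n => int_map F (svalP m) i)) \0 :
  {linear at_int F n i -> holim_deg F n i}.

Definition holim_diag (n : int) : cochain_map (at_int F n) (holim_at F n).
Proof.
exists (holim_diag_fun n) => i j ij x; apply: holim_eq => m; first exact: cmapE.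
rewrite holim_diff2 /= (int_mapM _ _ (svalP (from_succ m))).
by rewrite subrr !linear0 addr0.
Defined.

Definition holim_diag_nat : nat_trans (pers_floor F) (holim F).
Proof.
exists (fun r => holim_diag (Num.floor r)) => r s rs.
apply: cochain_map_ext => i x; apply: holim_eq => m //=.
exact: (int_mapM (le_floor rs) (svalP m)).
Defined.

(* The projection onto the first entry is not natural, but it is a
   quasi-isomorphism at each index. *)
Lemma quasi_iso_holim_proj n : quasi_iso (holim_proj n).
Proof.
apply/quasi_isoP; split=> i; last exact: holim_proj_inj.
move=> y dy; exists (holim_diag n i y); first exact: closed_cmap.
have -> : holim_proj n i (holim_diag n i y) = y.
  by rewrite /= /int_map pmor1.
by rewrite subrr; apply: cobounds0.
Qed.

(** The diagonal is at each index a section of the quasi-isomorphism [holim_proj]. *)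
Lemma weak_equiv_holim_diag : weak_equiv holim_diag_nat.
Proof.
move=> r; apply: (quasi_iso_cancel (gf := cochain_idmap _) _
  (quasi_iso_holim_proj _)); first by move=> i x; rewrite /= /int_map pmor1.
by apply: quasi_iso_bij => i; exists idfun.
Qed.

(** * Strictification of a map that is natural up to coboundaries *)

Context (P : pers R (Ch K)).
Context (P0 : forall r i j (ij : j = i + 1) (v : (pob P r : cochain K) i),
  cdiff (pob P r : cochain K) ij v = 0).
Context (s : forall r, cochain_map (pob P r) (pob F r)).
Context (s_quasi_iso : forall r, quasi_iso (s r)).
Context (s_nat : forall r t (rt : r <= t) i (v : (pob P r : cochain K) i),
  cobounds ((pmor F rt : cochain_map _ _) i (s r i v) -
            s t i ((pmor P rt : cochain_map _ _) i v))).

Let s_int (m : int) : cochain_map (at_int P m) (at_int F m) := s m%:~R.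

(** [s_nat] gives a primitive for each [v] separately; lifting along the differential makes the
    choice linear in [v]. *)
Let homotopy_ex (m i : int) :
  exists h : {linear at_int P m i -> at_int F (m + 1) (i - 1)}, forall v,
    cdiff (at_int F (m + 1)) (esym (subrK 1 i)) (h v) =
    int_map F (le_succ m) i (s_int m i v) -
    s_int (m + 1) i (int_map P (le_succ m) i v).
Proof.
pose g := (int_map F (le_succ m) i \o s_int m i) \-
  (s_int (m + 1) i \o int_map P (le_succ m) i).
apply: (linear_lift (g := g)) => v.
have [y ey] := cobounds_at (esym (subrK 1 i)) (s_nat (ler_intr R (le_succ m)) v).
by exists y; rewrite -ey.
Qed.

Let homotopy m i := sval (cid (homotopy_ex m i)).
Let homotopyE m i := svalP (cid (homotopy_ex m i)).

(** A sequence has only consecutive steps, so one homotopy per integer suffices. Each entry first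
    moves [v] strictly within [P] to index [m], which is what makes the lift natural. *)
Let homotopy_lift_fun n i : {linear at_int P n i -> holim_deg F n i} :=
  linear_pair
    (dprod_lift (fun m : from n => s_int (sval m) i \o int_map P (svalP m) i))
    (dprod_lift (fun m : from n => homotopy (sval m) i \o int_map P (svalP m) i)).

Definition homotopy_lift (n : int) : cochain_map (at_int P n) (holim_at F n).
Proof.
exists (homotopy_lift_fun n) => i j ij v; rewrite P0 linear0; apply: holim_eq => m.
  by rewrite /= -cmapE [cdiff _ _ _]P0 linear0.
(* The second entry is [u s - s u - d h]. The structure map of [P] to [m + 1] is split at [m] so
   that [homotopyE] applies and cancels it. *)
rewrite [RHS]holim_diff2 /= -(int_mapM (svalP m) (le_succ (sval m))).
rewrite -homotopyE.
rewrite (ccast_cdiff _ _ (succ_pred_deg ij)) subrr.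
by [].
Defined.

Definition homotopy_lift_nat : nat_trans (pers_floor P) (holim F).
Proof.
exists (fun r => homotopy_lift (Num.floor r)) => r t rt.
apply: cochain_map_ext => i x; apply: holim_eq => m /=.
  congr (s_int _ _ _); exact: (int_mapM (le_floor rt) (svalP m)).
congr (homotopy _ _ _); exact: (int_mapM (le_floor rt) (svalP m)).
Defined.

(** The first entry of the lift is [s] itself, and [holim_proj] can be cancelled. *)
Lemma weak_equiv_homotopy_lift : weak_equiv homotopy_lift_nat.
Proof.
move=> r; apply: (quasi_iso_cancel (gf := s_int _) _
  (quasi_iso_holim_proj _)); last exact: s_quasi_iso.
by move=> i x; rewrite /= /int_map pmor1.
Qed.

(** The zigzag is [F <- pers_floor F -> holim F <- pers_floor P -> P]. *)
Lemma zigzag_formal :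
  weak_equiv (pers_floor_map F) -> weak_equiv (pers_floor_map P) -> zigzag F P.
Proof.
move=> wF wP.
apply: zigzag_fwd wP; apply: zigzag_bwd weak_equiv_homotopy_lift.
apply: zigzag_fwd weak_equiv_holim_diag.
exact: zigzag_bwd (zigzag_refl _) wF.
Qed.

End RectificationMaps.

(** * Persistent complexes with zero differential *)

Section ZeroDifferential.
Context (K : fieldType).

Definition zero_cochain (V : int -> lmodType K) : cochain K.
Proof. by exists V (fun i j ij => \0). Defined.

Definition zero_cochain_map (V W : int -> lmodType K)
  (f : forall i, {linear V i -> W i}) :
  cochain_map (zero_cochain V) (zero_cochain W).
Proof. by exists f => i j ij x; rewrite linear0. Defined.

Context (R : realType).
Implicit Types P Q : int -> pers R (Vect K).

Definition zero_pers P : pers R (Ch K).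
Proof.
exists (fun r => zero_cochain (fun i => pob (P i) r) : ob (Ch K))
  (fun r s rs => zero_cochain_map (fun i => pmor (P i) rs)).
- by move=> r rr; apply: cochain_map_ext => i x /=; rewrite pmor1.
- move=> r s t rs st rt; apply: cochain_map_ext => i x /=.
  by rewrite (pmorM (P i) rs st rt).
Defined.

(** With zero differentials any family of linear maps is a cochain map, so the degrees can be
    treated independently. *)
Lemma interleaved_zero_pers P Q e :
  (forall i, interleaved (P i) (Q i) e) ->
  interleaved (zero_pers P) (zero_pers Q) e.
Proof.
move=> PQ; have [e0 _] := PQ 0; exists e0.
(* An interleaving carries one proof of [0 <= e]; the one from degree 0 is imposed on all
   degrees. *)
have ex i : exists f : nat_trans (P i) (pers_shift (Q i) e) *
                       nat_trans (Q i) (pers_shift (P i) e),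
    (forall r, compm (ncomp f.2 (r + e)) (ncomp f.1 r) = pmor (P i) (le_shift2 r e0)) /\
    (forall r, compm (ncomp f.1 (r + e)) (ncomp f.2 r) = pmor (Q i) (le_shift2 r e0)).
  have [e0' [phi [psi [h h']]]] := PQ i.
  by exists (phi, psi); rewrite (bool_irrelevance e0 e0').
have [f fP] := dep_choice ex.
have @lift (P' Q' : int -> pers R (Vect K))
    (g : forall i, nat_trans (P' i) (pers_shift (Q' i) e)) :
    nat_trans (zero_pers P') (pers_shift (zero_pers Q') e).
  exists (fun r => zero_cochain_map (fun i => ncomp (g i) r)) => r s rs.
  apply: cochain_map_ext => i x.
  exact: (congr1 (fun h : {linear _ -> _} => h x) (natural (g i) rs)).
exists (lift _ _ (fun i => (f i).1)), (lift _ _ (fun i => (f i).2)).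
split=> r; apply: cochain_map_ext => i x.
  exact: (congr1 (fun h : {linear _ -> _} => h x) ((fP i).1 r)).
exact: (congr1 (fun h : {linear _ -> _} => h x) ((fP i).2 r)).
Qed.

End ZeroDifferential.

(** * Linear choice of cocycle representatives *)

Section LinearRepresentatives.
Context (K : fieldType).
Implicit Types X Y : cochain K.

(** The projection from cocycles to cohomology splits linearly, whereas [coh_rep] need not be
    linear. *)
Lemma coh_lin_ex X k : exists f : {linear cohomology X k -> cocycle X k},
  forall c, coh_class (f c) = c.
Proof.
have [|f fP] := linear_lift (f := to_linear (@coh_class_linear K X k))
  (g := idfun : {linear cohomology X k -> cohomology X k}).
  by move=> c; exists (coh_rep c); apply: coh_repK.
by exists f.
Qed.

Definition coh_lin X k : {linear cohomology X k -> X k} :=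
  val \o sval (cid (coh_lin_ex X k)).

Lemma coh_linP X k c : exists2 z : cocycle X k, coh_class z = c & val z = coh_lin X k c.
Proof. by eexists; first exact: svalP (cid (coh_lin_ex X k)) c. Qed.

Lemma closed_coh_lin X k c : closed (coh_lin X k c).
Proof. by have [z _ <-] := coh_linP c; apply: cocycle_closed. Qed.

Lemma coh_lin_surj X k (x : X k) : closed x -> exists c, cobounds (x - coh_lin X k c).
Proof.
move=> /closed_cocycle[z <-]; exists (coh_class z).
by have [z' zz' <-] := coh_linP (coh_class z); apply/coh_class_eq.
Qed.

Lemma coh_lin_inj X k c : cobounds (coh_lin X k c) -> c = 0.
Proof.
have [z <- <-] := coh_linP c => zb.
have -> : 0 = coh_class (0 : cocycle X k).
  by rewrite [RHS](linear0 (to_linear (@coh_class_linear K X k))).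
by apply/coh_class_eq; rewrite [val 0]linear0 subr0.
Qed.

(** Both representatives have the same class. The remaining coboundary is the defect that the
    homotopies in [holim] absorb. *)
Lemma coh_lin_nat X Y (f : cochain_map X Y) k c :
  cobounds (f k (coh_lin X k c) - coh_lin Y k (cohomology_map f c)).
Proof.
have [z zc <-] := coh_linP c; have [z' zc' <-] := coh_linP (cohomology_map f c).
by apply/(coh_class_eq (cocycle_map f z)); rewrite zc' -zc cohomology_mapE.
Qed.

Lemma closed_shift X l k (x : X (k + l)) :
  closed (X := cochain_shift l X) x <-> closed x.
Proof.
split=> dx; first exact: (closedE (ij := shift_deg l erefl) (dx _ erefl)).
by move=> j jk /=; apply: dx.
Qed.

Lemma cobounds_shift X l k (x : X (k + l)) :
  cobounds (X := cochain_shift l X) x <-> cobounds x.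
Proof.
split=> [[j [jk [y ->]]]|]; first exact: cobounds_cdiff.
have kE : k = k - 1 + 1 by rewrite subrK.
by move=> /(cobounds_at (shift_deg l kE))[y ->]; exists (k - 1), kE, y.
Qed.

End LinearRepresentatives.

(** * Formality of [alpha M] *)

Section Alpha.
Context (R : realType) (K : fieldType) (M : dgmod K).

Lemma upow_ccast m n i i' j j' (ij : j' = i' + 2 * m%:Z) (ij' : j = i + 2 * n%:Z)
  (ei : i = i') (ej : j = j') (x : M i) :
  upow ij (ccast M ei x) = ccast M ej (upow ij' x).
Proof. case: i' / ei ij => ij; case: j' / ej ij => ij.
by rewrite !ccast_id (upow_irr ij ij'). Qed.

(** Equal degrees force the exponent to be 0, where the action is the identity. *)
Lemma upow_bij n i j (ij : j = i + 2 * n%:Z) : i = j -> bijective (upow (M := M) ij).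
Proof.
move=> e; case: j / e ij => ij; have i0 : i = i + 2 * 0%:Z by rewrite mulr0 addr0.
by exists idfun => x; rewrite (upow_irr ij i0) upow0.
Qed.

Lemma alpha_quasi_iso (r s : R) (rs : r <= s) :
  Num.floor r = Num.floor s -> quasi_iso (pmor (alpha R M) rs).
Proof.
by move=> e; apply: quasi_iso_bij => i; apply: upow_bij; rewrite e.
Qed.

Lemma floorD_int (r : R) (m : int) : Num.floor (r + m%:~R) = Num.floor r + m.
Proof. by rewrite floorDrz ?intr_int // intrKfloor. Qed.

(* The model of H^i (alpha M): i = (i %% 2) + 2 (i %/ 2), and u-periodicity of
   alpha turns the degree shift by 2 (i %/ 2) into a shift of r by i %/ 2. *)
Definition nu_family (i : int) : pers R (Vect K) :=
  pers_shift (nu R (i %% 2)%Z M) (i %/ 2)%Z%:~R.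

Fact nu_family_deg (r : R) (i : int) :
  (i %% 2)%Z + 2 * Num.floor (r + (i %/ 2)%Z%:~R) = i + 2 * Num.floor r.
Proof.
rewrite floorD_int mulrDr addrCA addrC; congr (_ + _).
by rewrite mulrC addrC -divz_eq.
Qed.

Definition nu_family_rep_fun (r : R) (i : int) :
    {linear pob (nu_family i) r -> M (i + 2 * Num.floor r)} :=
  ccast M (nu_family_deg r i) \o
  (coh_lin (cochain_shift (2 * Num.floor (r + (i %/ 2)%Z%:~R)) M) (i %% 2)%Z :
    {linear pob (nu_family i) r -> M _}).

Definition nu_family_rep (r : R) :
  cochain_map (pob (zero_pers nu_family) r) (pob (alpha R M) r).
Proof.
exists (@nu_family_rep_fun r) => i j ij c.
rewrite linear0; apply/esym.
have dc : closed (nu_family_rep_fun r i c).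
  by apply/closed_ccast/closed_shift/closed_coh_lin.
exact: dc.
Defined.

Lemma zigzag_alpha : zigzag (alpha R M) (zero_pers nu_family).
Proof.
apply: (zigzag_formal _ (s := nu_family_rep)) => //.
(* Every cocycle is cohomologous to a chosen representative, and a representative that cobounds has
   class zero. *)
- move=> r; apply/quasi_isoP; split=> i.
    move=> y /closed_shift dy; pose e := nu_family_deg r i.
    have [c yc] := coh_lin_surj
      (X := pob (alpha R M) (r + (i %/ 2)%Z%:~R)) (k := (i %% 2)%Z)
      (x := ccast M (esym e) y) ((closed_shift _).2 ((closed_ccast _ _).2 dy)).
    exists c => //; apply: (cobounds_shift (X := M) _).2.
    move: yc => /(cobounds_shift (X := M) _).1/(cobounds_ccast e).
    by rewrite linearB ccastKV.
  move=> c _ /(cobounds_shift (X := M) _).1 cb.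
  suff -> : c = 0 by apply: cobounds0.
  apply: coh_lin_inj; apply: (cobounds_shift (X := M) _).2.
  exact: (cobounds_ccast (nu_family_deg r i) _).1 cb.
(* Naturality up to coboundaries is that of [coh_lin] for the structure map at the shifted indices;
   [upow_ccast] moves the cast past the power of [u]. *)
- move=> r t rt i c; apply: (cobounds_shift (X := M) _).2.
  pose rtm : r + (i %/ 2)%Z%:~R <= t + (i %/ 2)%Z%:~R := le_shift _ rt.
  have := coh_lin_nat (alpha_map M rtm) (k := (i %% 2)%Z) c.
  move=> /cobounds_shift/(cobounds_ccast (nu_family_deg t i)); rewrite linearB.
  congr (cobounds (_ - _)).
  exact/esym/upow_ccast.
(* [alpha M] and the model change only at integers, so replacing [r] by its floor is a weak
   equivalence for both. *)
- by move=> r; apply: alpha_quasi_iso; rewrite intrKfloor.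
move=> r; apply: quasi_iso_bij => i; apply: alpha_quasi_iso.
by rewrite !floorD_int intrKfloor.
Qed.

End Alpha.

(** * Comparison of the two distances *)

Lemma homotopy_interleaved_alpha (R : realType) (K : fieldType) (M N : dgmod K) e :
  interleaved (nu R 0 M) (nu R 0 N) e -> interleaved (nu R 1 M) (nu R 1 N) e ->
  homotopy_interleaved (alpha R M) (alpha R N) e.
Proof.
move=> h0 h1; exists (zero_pers (nu_family R M)), (zero_pers (nu_family R N)).
split; [exact: zigzag_alpha | exact: zigzag_alpha |].
apply: interleaved_zero_pers => i; apply: interleaved_shift.
(* The remainder is 0 or 1, where the two hypotheses apply. *)
have : (i %% 2)%Z < 2 by rewrite ltz_mod.
have : 0 <= (i %% 2)%Z by rewrite modz_ge0.
by case: (i %% 2)%Z => [[|[|]]|].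
Qed.

Theorem theorem4p7 (R : realType) (K : fieldType) (M N : dgmod K) :
  d_HI (alpha R M) (alpha R N) = maxe (d_CohI R 0%R M N) (d_CohI R 1%R M N).
Proof.
apply/eqP; rewrite eq_le; apply/andP; split.
  (* The infima need not be attained: if both were below [d_HI], there would be interleavings at
     some [e0] and [e1] below it, and their maximum would contradict the lower bound. *)
  rewrite leNgt gt_max; apply/negP => /andP[].
  move=> /ereal_inf_lt[_ [e0 h0 <-] lt0] /ereal_inf_lt[_ [e1 h1 <-] lt1].
  have : (d_HI (alpha R M) (alpha R N) <= (Num.max e0 e1)%:E)%E.
    apply: ereal_inf_lbound; exists (Num.max e0 e1) => //.
    apply: homotopy_interleaved_alpha.
      by apply: interleaved_le h0; rewrite le_max lexx.
    by apply: interleaved_le h1; rewrite le_max lexx orbT.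
  apply/negP; rewrite -ltNge EFin_max gt_max; exact/andP.
(* Each parameter of a homotopy interleaving is one for both cohomology modules, and the infimum
   over a larger set is smaller. *)
by rewrite ge_max; apply/andP; split; apply: ereal_inf_le_tmp => _ [e he <-];
  exists e => //; apply: homotopy_interleaved_cohomology he.
Qed.
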